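(* Let $G\cong(0,\underbrace{1,\ldots,1}_{t_1},0,\underbrace{1,\ldots,1}_{t_2},\ldots,0,\underbrace{1,\ldots,1}_{t_s})$, where $s\ge 2$ and $t_i\ge 1$ for $i=1,2,\ldots,s$. If $t_s=1$, then $q(G)=3$; otherwise, if $t_s\ge 2$, then $q(G)=2$.
   Context: For a simple graph $G$ on $n$ vertices, $S(G)$ is the set of all real symmetric $n\times n$ matrices $A=(a_{ij})$ such that for $i\neq j$, $a_{ij}\neq 0$ if and only if $ij\in E(G)$ (diagonal entries are unrestricted). $q(A)$ is the number of distinct eigenvalues of $A$ and $q(G)=\min\{q(A): A\in S(G)\}$. The notation $G\cong(b_1,\ldots,b_n)$, with $b_i\in\{0,1\}$ and $b_1=0$, means that $G$ is the threshold graph with creation sequence $(b_1,\ldots,b_n)$: its vertices are $v_1,\ldots,v_n$ and, for $i<j$, $v_i$ and $v_j$ are adjacent if and only if $b_j=1$. *)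

(* Defs.v *)
From HB Require Import structures.
From mathcomp Require Import all_boot all_order all_algebra finmap.
From mathcomp Require Import boolp classical_sets cardinality reals.

Set Implicit Arguments.
Unset Strict Implicit.
Unset Printing Implicit Defensive.

Import Order.TTheory GRing.Theory Num.Theory.
Local Open Scope classical_set_scope.
Local Open Scope ring_scope.

Record sgraph (n : nat) := SGraph {
  adj :> rel 'I_n;
  adj_sym : symmetric adj;
  adj_irr : irreflexive adj }.

Definition Smx (R : realType) n (G : sgraph n) : set 'M[R]_n :=
  [set A | A^T = A /\ forall i j : 'I_n, i != j -> (A i j != 0 <-> G i j)].

(* [fset_set] is a junk value on infinite sets only; see
   [finite_eigenvalues]. *)
Definition qmx (R : realType) n (A : 'M[R]_n) : nat :=
  #|` fset_set [set a : R | eigenvalue A a]|%fset.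

Lemma finite_eigenvalues (R : realType) n (A : 'M[R]_n) :
  finite_set [set a : R | eigenvalue A a].
Proof.
apply: contrapT => inf; pose p := char_poly A.
have p0 : p != 0 by exact/monic_neq0/char_poly_monic.
have [X sX cX] := infinite_set_fset (size p) inf.
suff /(max_poly_roots p0)/(_ (fset_uniq X)) : all (root p) X.
  by rewrite ltnNge cX.
by apply/allP => a /sX /=; rewrite eigenvalue_root_char.
Qed.

Lemma exists_qmx (R : realType) n (G : sgraph n) :
  exists k : nat, `[< exists2 A : 'M[R]_n, Smx G A & qmx A = k >].
Proof.
pose A : 'M[R]_n := \matrix_(i, j) (G i j)%:R.
exists (qmx A); apply/asboolP; exists A => //; split=> [|i j _].
  by apply/matrixP => i j; rewrite !mxE adj_sym.
by rewrite mxE pnatr_eq0 eqb0 negbK.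
Qed.

Definition qgraph (R : realType) n (G : sgraph n) : nat :=
  ex_minn (exists_qmx R G).

(* G is the threshold graph with creation sequence b; the bijection v lists
   the vertices v_1, ..., v_n, numbered here from 0. *)
Definition is_threshold n (G : sgraph n) (b : seq bool) : Prop :=
  ohead b = Some false /\
  exists v : 'I_(size b) -> 'I_n, bijective v /\
    forall i j : 'I_(size b), (i < j)%N -> G (v i) (v j) = nth false b j.

Definition creation_seq (s : nat) (t : nat -> nat) : seq bool :=
  flatten [seq false :: nseq (t i) true | i <- index_iota 1 s.+1].

(* Main.v *)
(** Lower bounds: a real symmetric matrix with eigenvalues in {a, b} satisfies
(A - a)(A - b) = 0, so with a = b it is scalar, and otherwise A^2 vanishes
wherever A does off the diagonal.  If t_s = 1, the isolated vertex of the last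
block has a single neighbour d, which it shares with v_1, so the corresponding
entry of A^2 is a single nonzero product.

Upper bounds: take A = X X^T, where the rows x of X are orthogonal exactly when
the vertices are not adjacent; A has its eigenvalues in {0, 1, 1 + |m|^2} when
X^T X = I + m^T m.  One builds, block by block, rows with X^T X = I - v^T v and
no row orthogonal to v: adjoining v itself gives an orthogonal projection
(t_s >= 2), while adding a new coordinate and the rows (0, c), (5/4 v, 9/16)
gives I + m^T m with m = (3/4 v, 15/16) (t_s = 1). *)

Require Import Defs.
From mathcomp Require Import all_boot all_order all_algebra.
From mathcomp Require Import finmap boolp classical_sets cardinality reals.
From mathcomp Require Import complex ring lra.

Set Implicit Arguments.
Unset Strict Implicit.
Unset Printing Implicit Defensive.

Import Order.TTheory GRing.Theory Num.Theory.
Local Open Scope ring_scope.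
Local Open Scope complex_scope.

(** * Spectral theorem and lower bounds on the number of eigenvalues *)

Lemma spectral_diag_eigenvalue (C : numClosedFieldType) n (A : 'M[C]_n) i :
  A \is normalmx -> eigenvalue A (spectral_diag A 0 i).
Proof.
move=> /orthomx_spectralP; set P := spectralmx A => defA.
have Pu : P \in unitmx by exact: spectral_unit.
(* Row [i] of [P] is a left eigenvector, since [P A = D P] with [D] diagonal; it is nonzero because
   [P] is invertible. *)
apply/eigenvalueP; exists (row i P).
  rewrite -row_mul [in row i _]defA !mulmxA mulmxV // mul1mx row_mul.
  by rewrite row_diag_mx -scalemxAl -rowE.
rewrite rowE; apply/eqP => /(congr1 (mulmx^~ (invmx P))).
rewrite mulmxK // mul0mx => /matrixP/(_ 0 i)/eqP.
by rewrite !mxE !eqxx oner_eq0.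
Qed.

(** Over [R[i]] the matrix is Hermitian, hence unitarily diagonalizable. Its diagonal form is real,
    so each diagonal entry is an eigenvalue of [A] over [R] and is killed by [(x - a)(x - b)]. *)
Lemma symmetric_two_eigenvalues (R : rcfType) n (A : 'M[R]_n) (a b : R) :
    A^T = A -> (forall x, eigenvalue A x -> x = a \/ x = b) ->
  (A - a%:M) *m (A - b%:M) = 0.
Proof.
move=> symA eigA; pose f : {rmorphism R -> R[i]} := real_complex R.
apply: (map_mx_inj (f := f)) => /=.
pose B := map_mx f A.
have hB : B \is hermsymmx.
  apply: realsym_hermsym; last first.
    by apply/mxOverP => i j; rewrite mxE /= complex_real.
  by apply/is_hermitianmxP; rewrite expr0 scale1r map_mx_id // /B map_trmx symA.
have nB := hermitian_normalmx hB.
have := nB => /orthomx_spectralP; set P := spectralmx B; set d := spectral_diag B.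
move=> defB.
have d_ab i : (d 0 i - f a) * (d 0 i - f b) = 0.
  have /mxOverP/(_ 0 i) := hermitian_spectral_diag_real hB.
  case/complex_realP => r dr.
  have := spectral_diag_eigenvalue i nB; rewrite -/d dr eigenvalue_root_char.
  rewrite -map_char_poly fmorph_root -eigenvalue_root_char => /eigA[] ->;
  by rewrite subrr ?mul0r ?mulr0.
have Pu : P \in unitmx by exact: spectral_unit.
have conjB c : B - (f c)%:M = invmx P *m (diag_mx d - (f c)%:M) *m P.
  by rewrite mulmxBr mulmxBl -defB scalar_mxC -mulmxA mulVmx // mulmx1.
rewrite map_mx0 map_mxM !map_mxB !map_scalar_mx -/B !conjB.
rewrite !mulmxA mulmxK // -(mulmxA (invmx P)).
suff -> : (diag_mx d - (f a)%:M) *m (diag_mx d - (f b)%:M) = 0.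
  by rewrite mulmx0 mul0mx.
rewrite -!diag_const_mx -!linearB /= mulmx_diag -[RHS](linear0 (@diag_mx _ _)).
congr diag_mx; apply/rowP => i; rewrite !mxE; exact: d_ab.
Qed.

Lemma qmx_le (R : realType) n (A : 'M[R]_n) (s : seq R) :
  (forall x, eigenvalue A x -> x \in s) -> (qmx A <= size s)%N.
Proof.
move=> eigA; apply: uniq_leq_size; first exact: fset_uniq.
by move=> x; rewrite in_fset_set ?inE; [exact: eigA | exact: finite_eigenvalues].
Qed.

Lemma qmx_spectrum (R : realType) n (A : 'M[R]_n) :
  exists2 s : seq R, size s = qmx A & forall x, eigenvalue A x -> x \in s.
Proof.
exists (fset_set [set a : R | eigenvalue A a]%classic) => // x eigx.
by rewrite in_fset_set ?inE //; exact: finite_eigenvalues.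
Qed.

(** With at most one eigenvalue [a], the square of [A - a] is zero. By symmetry its diagonal entry
    at [i] is the sum of squares of row [i], so that row vanishes, against the edge. *)
Lemma qmx_ge2 (R : realType) n (G : sgraph n) (A : 'M[R]_n) (i j : 'I_n) :
  Smx G A -> G i j -> (2 <= qmx A)%N.
Proof.
move=> [symA patA] Gij; rewrite ltnNge; apply/negP => qA.
have [s sz eigA] := qmx_spectrum A.
have neq_ij : i != j by apply/eqP => eij; rewrite eij adj_irr in Gij.
pose a := nth 0 s 0.
have {}eigA x : eigenvalue A x -> x = a \/ x = a.
  move: (eigA x); rewrite /a; move: qA; rewrite -sz.
  case: (s) => [|y [|]] //= _ mem /mem; first by rewrite in_nil.
  by rewrite inE => /eqP; left.
have /matrixP/(_ i i) := symmetric_two_eigenvalues symA eigA.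
rewrite [LHS]mxE [RHS]mxE => sq0.
have symB k : (A - a%:M) k i = (A - a%:M) i k.
  by rewrite -[in LHS]symA -[in LHS]tr_scalar_mx -linearB mxE.
have /(_ j isT)/eqP : forall k, true -> (A - a%:M) i k * (A - a%:M) k i = 0.
  by apply: psumr_eq0P sq0 => k _; rewrite symB -expr2 sqr_ge0.
rewrite symB mulf_eq0 orbb !mxE (negPf neq_ij) mulr0n subr0.
by apply/negP; apply/patA.
Qed.

Lemma qmx_ge3_pendant (R : realType) n (G : sgraph n) (A : 'M[R]_n)
    (u d w : 'I_n) :
    Smx G A -> G u d -> G d w -> w != u ->
    (forall x, G u x -> x = d) ->
  (3 <= qmx A)%N.
Proof.
move=> [symA patA] Gud Gdw neq_wu Nu; rewrite ltnNge; apply/negP => qA.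
have [s sz eigA] := qmx_spectrum A.
(* The defaults are harmless: an empty [s] allows no eigenvalue, and for a singleton [b] equals
   [a]. *)
pose a := nth 0 s 0; pose b := nth a s 1.
have {}eigA x : eigenvalue A x -> x = a \/ x = b.
  move: (eigA x); rewrite /a /b; move: qA; rewrite -sz.
  case: (s) => [|y [|z [|]]] //= _ mem /mem; rewrite ?in_nil //.
    by rewrite inE => /eqP; left.
  by rewrite !inE => /orP[]/eqP; [left|right].
have neq_ud : u != d by apply/eqP => e; rewrite e adj_irr in Gud.
have neq_dw : d != w by apply/eqP => e; rewrite e adj_irr in Gdw.
have A0 x : x != u -> x != d -> A u x = 0.
  move=> xu xd; apply/eqP/negP => /negP; rewrite eq_sym in xu.
  by move/(patA _ _ xu) => /Nu /eqP; rewrite (negPf xd).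
have Auw : A u w = 0 by rewrite A0 // eq_sym.
have /matrixP/(_ u w) := symmetric_two_eigenvalues symA eigA.
(* At [(u, w)] only the entry of [A *m A] remains. Its term at [u] contains [A u w = 0], and every
   index other than [u] and [d] is a non-neighbour of [u]. *)
rewrite mulmxBl !mulmxBr scalar_mxC !mul_scalar_mx.
rewrite !mxE Auw !mulr0 subr0 (negPf (_ : u != w)) 1?eq_sym // mulr0n mulr0 !subr0.
rewrite (bigD1 d) //= (bigD1 u) //= Auw mulr0 add0r big1 => [|x /andP[xd xu]].
  apply/eqP; rewrite addr0 mulf_neq0 //; [exact/patA | exact/patA].
by rewrite A0 ?mul0r.
Qed.

(** * Gram matrices of labelled rows *)

Definition dot (R : pzRingType) k (x y : 'rV[R]_k) : R := (x *m y^T) 0 0.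

(** The boolean is the creation bit of the row's vertex. The relation is meant for [p] before [q],
    where the later bit decides adjacency. *)
Definition gram_rel (R : pzRingType) k : rel (bool * 'rV[R]_k) :=
  fun p q => (dot p.2 q.2 != 0) == q.1.

(** This is [X^T X] for the matrix [X] whose rows are the vectors of [u]. *)
Definition frame_op (R : pzRingType) k (u : seq (bool * 'rV[R]_k)) : 'M[R]_k :=
  \sum_(p <- u) p.2^T *m p.2.

Lemma dotC (R : comPzRingType) k (x y : 'rV[R]_k) : dot x y = dot y x.
Proof. by rewrite /dot -[y *m _]trmxK trmx_mul trmxK [RHS]mxE. Qed.

Lemma mulmx_dot (R : pzRingType) k (x y : 'rV[R]_k) : x *m y^T = (dot x y)%:M.
Proof. by rewrite [LHS]mx11_scalar. Qed.

(** For a left eigenvector [z], the row [y = z X] satisfies [y + (y.m) m = x y]. If [y = 0] then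
    [x = 0]; if [y] is nonzero and orthogonal to [m] then [x = 1]; otherwise pairing with [m] gives
    the third value. *)
Lemma gram_eigenvalues (R : fieldType) n k (X : 'M[R]_(n, k)) (m : 'rV_k) x :
    X^T *m X = 1%:M + m^T *m m -> eigenvalue (X *m X^T) x ->
  x \in [:: 0; 1; 1 + dot m m].
Proof.
move=> XX /eigenvalueP[z zX z0].
have zXX : z *m X + dot (z *m X) m *: m = x *: (z *m X).
  rewrite scalemxAl -zX !mulmxA -(mulmxA _ X^T) XX mulmxDr mulmx1.
  by rewrite mulmxA mulmx_dot mul_scalar_mx.
rewrite !inE; have [->//|x0 /=] := eqVneq x 0.
have y0 : z *m X != 0.
  apply: contra z0 => /eqP y0.
  by move/eqP: zX; rewrite mulmxA y0 mul0mx eq_sym scaler_eq0 (negPf x0).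
set y := z *m X in y0 zXX *.
have [->//|x1 /=] := eqVneq x 1.
have ym : dot y m *: m = (x - 1) *: y by rewrite scalerBl scale1r -zXX addrC addKr.
have d0 : dot y m != 0.
  apply: contra y0 => /eqP d0; move/eqP: ym.
  by rewrite d0 scale0r eq_sym scaler_eq0 subr_eq0 (negPf x1).
have /(congr1 (fun v => dot v m)) := ym.
rewrite /dot -!scalemxAl [LHS]mxE [RHS]mxE -!/(dot _ _) mulrC => /(mulIf d0) ->.
by rewrite addrC subrK.
Qed.

Lemma gram_realization (R : realType) n (G : sgraph n) k
    (u : seq (bool * 'rV[R]_k)) (m : 'rV_k) :
    is_threshold G (unzip1 u) -> pairwise (@gram_rel R k) u ->
    frame_op u = 1%:M + m^T *m m ->
  exists2 A : 'M[R]_n, Smx G A &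
    forall x, eigenvalue A x -> x \in [:: 0; 1; 1 + dot m m].
Proof.
move=> [_ [v [[w vK wK] Gv]]] gram_u opu.
pose p0 : bool * 'rV[R]_k := (false, 0).
pose X : 'M[R]_(n, k) := \matrix_i (nth p0 u (w i)).2.
have XE i j : (X *m X^T) i j = dot (nth p0 u (w i)).2 (nth p0 u (w j)).2.
  by rewrite /dot !mxE; apply: eq_bigr => l _; rewrite !mxE.
have symX : (X *m X^T)^T = X *m X^T by rewrite trmx_mul trmxK.
exists (X *m X^T); last first.
  move=> x; apply: gram_eigenvalues; rewrite -opu /frame_op.
  rewrite (big_nth p0) -(size_map fst u) big_mkord (reindex w) /=; last first.
    by exists v => i _.
  apply/matrixP => i j; rewrite mxE summxE; apply: eq_bigr => l _.
  by rewrite !mxE big_ord1 !mxE.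
split=> // i j; wlog lt_ij : i j / (w i < w j)%N.
  move=> IH ij; case: (ltngtP (w i) (w j)) => [lt|gt|eq]; first exact: IH.
    by rewrite -symX mxE adj_sym; apply: IH; rewrite // eq_sym.
  by case/eqP: ij; rewrite -(wK i) -(wK j); congr v; apply/val_inj.
move=> _; rewrite -{2}(wK i) -{2}(wK j) Gv // XE.
have /(pairwiseP p0)/(_ (w i) (w j)) := gram_u.
have szw l : (w l < size u)%N by rewrite -(size_map fst).
move=> /(_ (szw i) (szw j) lt_ij)/eqP ->.
by rewrite (nth_map p0).
Qed.

(** * Frames with [X^T X = I - v^T v], built block by block *)

Lemma dotZ (R : comPzRingType) k a b (x y : 'rV[R]_k) :
  dot (a *: x) (b *: y) = a * b * dot x y.
Proof. by rewrite /dot linearZ /= -scalemxAl -scalemxAr !mxE mulrA. Qed.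

Lemma dot_row_mx (R : pzRingType) k l (x y : 'rV[R]_k) (a b : 'rV[R]_l) :
  dot (row_mx x a) (row_mx y b) = dot x y + dot a b.
Proof. by rewrite /dot tr_row_mx mul_row_col mxE. Qed.

Lemma dot0v (R : pzRingType) k (x : 'rV[R]_k) : dot 0 x = 0.
Proof. by rewrite /dot mul0mx mxE. Qed.

Lemma dot_scalar (R : pzRingType) (a b : R) : dot a%:M b%:M = a * b.
Proof. by rewrite /dot tr_scalar_mx -scalar_mxM mxE eqxx. Qed.

Definition pad (R : pzRingType) k (p : bool * 'rV[R]_k) : bool * 'rV[R]_(k + 1) :=
  (p.1, row_mx p.2 0).

Lemma frame_op_pad (R : pzRingType) k (u : seq (bool * 'rV[R]_k)) :
  frame_op (map (@pad R k) u) = block_mx (frame_op u) 0 0 0.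
Proof.
rewrite /frame_op; elim: u => [|p u IH]; first by rewrite !big_nil block_mx_const.
rewrite !big_cons {}IH /= tr_row_mx mul_col_row add_block_mx.
by rewrite !linear0 !mul0mx !mulmx0 !addr0.
Qed.

Lemma gram_rel_pad (R : comPzRingType) k (p q : bool * 'rV[R]_k) :
  gram_rel (pad p) (pad q) = gram_rel p q.
Proof. by rewrite /gram_rel /= dot_row_mx dot0v addr0. Qed.

(* Then the rows of [u] followed by [v] have as Gram matrix an orthogonal projection
   with the pattern of the threshold graph of [rcons b true]. *)
Definition dominated_frame (R : realFieldType) (b : seq bool) : Prop :=
  exists k (u : seq (bool * 'rV[R]_k)) (v : 'rV[R]_k),
  [/\ unzip1 u = b, pairwise (@gram_rel R k) u,
      frame_op u = 1%:M - v^T *m v,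
      all (fun p => dot p.2 v != 0) u & 0 < dot v v].

Lemma dominated_frame1 (R : realFieldType) : dominated_frame R [:: false].
Proof.
exists 1, [:: (false, (4 / 5)%:M)], (3 / 5)%:M; split=> //=.
- rewrite /frame_op big_seq1 /= !tr_scalar_mx -!scalar_mxM -raddfB /=.
  by congr _%:M; field.
- by rewrite dot_scalar andbT; rewrite lt0r_neq0 //; lra.
- by rewrite dot_scalar; lra.
Qed.

(** Since [9/25 + 16/25 = 1], the defect [v^T v] splits into a new row [3/5 v] and a new defect
    vector [4/5 v], both parallel to [v]. *)
Lemma dominated_frame_true (R : realFieldType) (b : seq bool) :
  dominated_frame R b -> dominated_frame R (rcons b true).
Proof.
move=> [k [u [v [ub gram_u op_u uv vv]]]].
exists k, (rcons u (true, (3 / 5) *: v)), ((4 / 5) *: v); split.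
- by rewrite /unzip1 map_rcons -ub.
- rewrite pairwise_rcons gram_u andbT; apply: sub_all uv => p pv.
  rewrite /gram_rel /= eqb_id -[p.2]scale1r dotZ mulf_neq0 //.
  by rewrite lt0r_neq0 //; lra.
- rewrite /frame_op big_rcons /= -/(frame_op u) op_u.
  rewrite !linearZ /= -!scalemxAl !scalerA.
  by apply/matrixP => i j; rewrite !mxE; field.
- rewrite all_rcons /= !dotZ mulf_neq0 ?lt0r_neq0 //=; last by lra.
  apply: sub_all uv => p pv; rewrite -[p.2]scale1r dotZ mulf_neq0 //.
  by rewrite lt0r_neq0 //; lra.
- by rewrite dotZ mulr_gt0 //; lra.
Qed.

(** A zero cannot enter alone: a row orthogonal to all others but not to [v] would be parallel to
    [v], making [v] orthogonal to the others. With a one added too, the cross blocks balance as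
    [3/5 . 4r = 4/5 . 3r], and the new corner requires [c^2 + 16 r^2 = 1 - 9 r^2]. *)
Lemma dominated_frame_false_true (R : realFieldType) (b : seq bool) :
  dominated_frame R b -> dominated_frame R (b ++ [:: false; true]).
Proof.
move=> [k [u [v [ub gram_u op_u uv vv]]]].
(* The new [v] and the new dominating row must not be orthogonal: this excludes
   one value of [r ^+ 2], so two choices suffice. *)
have [r [c [r0 c0 rc vr]]] : exists r c : R,
    [/\ r != 0, c != 0, c ^+ 2 + 25 * r ^+ 2 = 1
      & 12 / 25 * dot v v - 12 * r ^+ 2 != 0].
  have [e|ne] := eqVneq (12 / 25 * dot v v - 12 * (3 / 25 : R) ^+ 2) 0.
    exists (4 / 25), (3 / 5).
    split; [rewrite lt0r_neq0 //; lra | rewrite lt0r_neq0 //; lra | by field |].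
    by apply/eqP => e'; clear -e e'; lra.
  exists (3 / 25), (4 / 5).
  by split=> //; [rewrite lt0r_neq0 //; lra | rewrite lt0r_neq0 //; lra | field].
pose z : 'rV[R]_(k + 1) := row_mx 0 c%:M.
pose w := row_mx ((3 / 5) *: v) (4 * r)%:M.
exists (k + 1)%N, (map (@pad R k) u ++ [:: (false, z); (true, w)]),
  (row_mx ((4 / 5) *: v) (- 3 * r)%:M).
have xv a p : a != 0 -> dot p v != 0 -> dot p (a *: v) != 0.
  by move=> a0 pv; rewrite -[p]scale1r dotZ mul1r mulf_neq0.
split.
- by rewrite /unzip1 map_cat -map_comp -ub.
- rewrite pairwise_cat; apply/and3P; split.
  + rewrite allrel_mapl; apply/allrelP => p q pu.
    rewrite !inE => /orP[]/eqP->; rewrite /gram_rel /= dot_row_mx dot0v addr0.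
      by rewrite dotC dot0v eqxx.
    by rewrite eqb_id xv ?(allP uv) // lt0r_neq0 //; lra.
  + rewrite pairwise_map; apply: sub_pairwise gram_u => p q /=.
    by rewrite gram_rel_pad.
  + rewrite /= !andbT /gram_rel /= dot_row_mx dot0v add0r dot_scalar eqb_id.
    by rewrite !mulf_neq0 // lt0r_neq0 //; lra.
- rewrite /frame_op big_cat /= -/(frame_op _) frame_op_pad op_u !big_cons big_nil.
  rewrite addr0 /= !tr_row_mx !mul_col_row !add_block_mx scalar_mx_block.
  rewrite opp_block_mx add_block_mx.
  congr block_mx; apply/matrixP => i j;
    rewrite !mxE ?big_ord1 !mxE ?ord1 ?eqxx /=; try by field.
  transitivity (c ^+ 2 + 25 * r ^+ 2 - 9 * r ^+ 2); first by ring.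
  by rewrite rc; ring.
- rewrite all_cat all_map /= !dot_row_mx !dot_scalar dot0v dotZ.
  apply/andP; split; last first.
    apply/and3P; split=> //.
      by rewrite add0r !mulf_neq0 ?oppr_eq0 ?pnatr_eq0.
    by apply: contra vr => /eqP e; apply/eqP; rewrite -[RHS]e; field.
  apply/allP => p pu /=; rewrite dot_row_mx dot0v addr0 xv ?(allP uv) //.
  by rewrite lt0r_neq0 //; lra.
- rewrite dot_row_mx dotZ dot_scalar -[X in _ + X]expr2.
  rewrite addr_gt0 //; first by rewrite !mulr_gt0 //; lra.
  by rewrite exprn_even_gt0 // mulf_neq0 ?oppr_eq0 ?pnatr_eq0.
Qed.

Lemma dominated_frame_nseq (R : realFieldType) (b : seq bool) m :
  dominated_frame R b -> dominated_frame R (b ++ nseq m true).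
Proof.
elim: m b => [|m IH] b fb; first by rewrite cats0.
by rewrite -cat_rcons; apply/IH/dominated_frame_true.
Qed.

Lemma creation_seqS s t :
  creation_seq s.+1 t = creation_seq s t ++ false :: nseq (t s.+1) true.
Proof.
rewrite /creation_seq /index_iota !subSS !subn0 -[in iota 1 s.+1](addn1 s).
by rewrite iotaD map_cat flatten_cat /= cats0 add1n.
Qed.

(** The first zero is the one-row frame; each later zero enters together with the first one of its
    block, which exists as [t i] is positive. *)
Lemma dominated_frame_creation (R : realFieldType) s t :
    (0 < s)%N -> (forall i, (1 <= i <= s)%N -> (1 <= t i)%N) ->
  dominated_frame R (creation_seq s t).
Proof.
case: s => // s _; elim: s => [|s IH] ht; rewrite creation_seqS.
  exact/(dominated_frame_nseq _ (dominated_frame1 R)).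
have : (0 < t s.+2)%N by rewrite ht //= leqnn.
case: (t s.+2) => // m _; rewrite -[_ :: _]/([:: false; true] ++ nseq m true) catA.
apply/dominated_frame_nseq/dominated_frame_false_true/IH => i /andP[i0 les].
by rewrite ht // i0 leqW.
Qed.

(** * Closing the last block *)

Lemma frame_true (R : realFieldType) (b : seq bool) :
  dominated_frame R b -> exists k (u : seq (bool * 'rV[R]_k)),
  [/\ unzip1 u = rcons b true, pairwise (@gram_rel R k) u & frame_op u = 1%:M].
Proof.
move=> [k [u [v [ub gram_u op_u uv _]]]]; exists k, (rcons u (true, v)); split.
- by rewrite /unzip1 map_rcons -ub.
- rewrite pairwise_rcons gram_u andbT; apply: sub_all uv => p pv.
  by rewrite /gram_rel /= eqb_id.
- by rewrite /frame_op big_rcons /= -/(frame_op u) op_u subrK.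
Qed.

Lemma frame_false_true (R : realFieldType) (b : seq bool) :
  dominated_frame R b -> exists k (u : seq (bool * 'rV[R]_k)) (m : 'rV[R]_k),
  [/\ unzip1 u = b ++ [:: false; true], pairwise (@gram_rel R k) u
    & frame_op u = 1%:M + m^T *m m].
Proof.
move=> [k [u [v [ub gram_u op_u uv _]]]].
(* The blocks match because [25/16 - 1 = 9/16], [5/4 . 9/16 = 3/4 . 15/16] and
   [25/16 + 81/256 = 1 + 225/256]. *)
pose z : 'rV[R]_(k + 1) := row_mx 0 (5 / 4)%:M.
pose w := row_mx ((5 / 4) *: v) (9 / 16)%:M.
exists (k + 1)%N, (map (@pad R k) u ++ [:: (false, z); (true, w)]),
  (row_mx ((3 / 4) *: v) (15 / 16)%:M).
split.
- by rewrite /unzip1 map_cat -map_comp -ub.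
- rewrite pairwise_cat; apply/and3P; split.
  + rewrite allrel_mapl; apply/allrelP => p q pu.
    rewrite !inE => /orP[]/eqP->; rewrite /gram_rel /= dot_row_mx dot0v addr0.
      by rewrite dotC dot0v eqxx.
    rewrite eqb_id -[p.2]scale1r dotZ mulf_neq0 ?(allP uv) //.
    by rewrite lt0r_neq0 //; lra.
  + rewrite pairwise_map; apply: sub_pairwise gram_u => p q /=.
    by rewrite gram_rel_pad.
  + rewrite /= !andbT /gram_rel /= dot_row_mx dot0v add0r dot_scalar eqb_id.
    by rewrite lt0r_neq0 //; lra.
- rewrite /frame_op big_cat /= -/(frame_op _) frame_op_pad op_u !big_cons big_nil.
  rewrite addr0 /= !tr_row_mx !mul_col_row !add_block_mx scalar_mx_block.
  rewrite add_block_mx.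
  by congr block_mx; apply/matrixP => i j;
    rewrite !mxE ?big_ord1 !mxE ?ord1 ?eqxx /=; field.
Qed.

(** * Extremal vertices of threshold graphs and the values of q *)

Lemma threshold_edge n (G : sgraph n) (b : seq bool) :
  (0 < size b)%N -> is_threshold G (rcons b true) -> exists i j, G i j.
Proof.
move=> b0 [_ [v [_ Gv]]].
have szb : size (rcons b true) = (size b).+1 by rewrite size_rcons.
pose i := cast_ord (esym szb) ord0; pose j := cast_ord (esym szb) ord_max.
by exists (v i), (v j); rewrite Gv //= nth_rcons ltnn eqxx.
Qed.

(** Take [u] the last zero, [d] the last vertex and [w] the first: only [d] comes after [u], and
    nothing before [u] is adjacent to it. *)
Lemma threshold_pendant n (G : sgraph n) (b : seq bool) :
    (0 < size b)%N -> is_threshold G (b ++ [:: false; true]) ->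
  exists u d w, [/\ G u d, G d w, w != u & forall x, G u x -> x = d].
Proof.
move=> b0 [_ [v [[w vK wK] Gv]]].
have szb : size (b ++ [:: false; true]) = (size b).+2 by rewrite size_cat addn2.
pose ord m : 'I__ := cast_ord (esym szb) (inord m).
have ordE m : (m < (size b).+2)%N -> ord m = m :> nat by move=> hm; rewrite /= inordK.
have o0 := ordE 0 isT; have od := ordE (size b).+1 (ltnSn _).
have ou := ordE (size b) (leqnSn _).
exists (v (ord (size b))), (v (ord (size b).+1)), (v (ord 0)); split.
- by rewrite Gv ?ou od // nth_cat ltnNge leqnSn /= subSnn.
- by rewrite adj_sym Gv ?o0 od // nth_cat ltnNge leqnSn /= subSnn.
- apply/eqP => /(can_inj vK) e; have := ou; rewrite -e o0 => sz.
  by rewrite -sz in b0.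
- move=> x; rewrite -(wK x); set y := w x => Guy; congr v.
  case: (ltngtP y (size b)) => [lt|gt|eq].
  + by move: Guy; rewrite adj_sym Gv ou // nth_cat ltnn subnn.
  + apply/ord_inj/eqP; rewrite od eqn_leq gt andbT -ltnS.
    by have := ltn_ord y; rewrite [X in (_ < X)%N]szb.
  + have ey : y = ord (size b) by apply/ord_inj; rewrite ou.
    by move: Guy; rewrite ey adj_irr.
Qed.

Lemma qgraph_eq (R : realType) n (G : sgraph n) c :
    (forall A : 'M[R]_n, Smx G A -> (c <= qmx A)%N) ->
    (exists2 A : 'M[R]_n, Smx G A & (qmx A <= c)%N) ->
  qgraph R G = c.
Proof.
move=> lb [A SA qA]; rewrite /qgraph; case: ex_minnP => _ /asboolP[B SB <-] minB.
apply/eqP; rewrite eqn_leq lb // andbT; apply: leq_trans qA.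
by apply/minB/asboolP; exists A.
Qed.

Theorem theorem5p2 (R : realType) (n s : nat) (t : nat -> nat) (G : sgraph n)
    (hs : (2 <= s)%N)
    (ht : forall i : nat, (1 <= i <= s)%N -> (1 <= t i)%N)
    (hG : is_threshold G (creation_seq s t)) :
  (t s = 1%N -> qgraph R G = 3%N) /\ ((2 <= t s)%N -> qgraph R G = 2%N).
Proof.
case: s => // s in hs ht hG *.
have ht' i : (1 <= i <= s)%N -> (1 <= t i)%N.
  by move=> /andP[i0 /leqW les]; rewrite ht ?i0.
have frame_s := dominated_frame_creation R hs ht'.
have size_s : (0 < size (creation_seq s t))%N.
  by case: (s) hs => // s' _; rewrite creation_seqS size_cat addnS.
rewrite creation_seqS in hG; split=> [ts1|].
  rewrite ts1 in hG; have [k [u [m [ub gram_u op_u]]]] := frame_false_true frame_s.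
  apply: qgraph_eq => [A SA|].
    have [x [d [w [Gxd Gdw wx Nx]]]] := threshold_pendant size_s hG.
    exact: qmx_ge3_pendant SA Gxd Gdw wx Nx.
  rewrite -ub in hG; have [A SA eigA] := gram_realization hG gram_u op_u.
  by exists A => //; exact: qmx_le eigA.
case: (t s.+1) hG => [|[|m]] // hG _.
(* The final one is reserved for the row [v]; the other [m.+1] ones still include a partner for the
   last zero. *)
have {}hG : is_threshold G (rcons (creation_seq s t ++ false :: nseq m.+1 true) true).
  by rewrite -cats1 -catA /= -[[:: true]]/(nseq 1 true) -nseqD addn1.
have {}frame_s : dominated_frame R (creation_seq s t ++ false :: nseq m.+1 true).
  rewrite -[_ :: _]/([:: false; true] ++ nseq m true) catA.
  exact/dominated_frame_nseq/dominated_frame_false_true.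
have [k [u [ub gram_u op_u]]] := frame_true frame_s.
apply: qgraph_eq => [A SA|].
  have [|x [y Gxy]] := threshold_edge _ hG; first by rewrite size_cat addnS.
  exact: qmx_ge2 SA Gxy.
rewrite -ub in hG.
(* With [m = 0] the third eigenvalue [1 + dot m m] collapses to [1]. *)
have [|A SA eigA] := gram_realization (m := 0) hG gram_u.
  by rewrite mulmx0 addr0.
exists A => //; apply: (qmx_le (s := [:: 0; 1])) => x /eigA.
by rewrite dot0v addr0 !inE orbb.
Qed.
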